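(* Suppose the functions $d=d(n)>3$ and $0<p=p(n)<1$ satisfy $(\log n)/d-3\log\log n\to\infty$ and $p^d n^{d-1}-2\log n\to\infty$, and furthermore $(np)^{d-1}=o(n)$. Then asymptotically almost surely $$(1-o(1))\frac{n}{(np)^{d-1}}\cdot\frac{\log n}{\log\big(n/(np)^{d-1}\big)}\le M(G(n,p))\le (1+o(1))\frac{n}{(np)^{d-1}}\ln n.$$
   Context: $G(n,p)$ is the Erdős–Rényi random graph on $n$ labeled vertices with each edge present independently with probability $p$; ''asymptotically almost surely'' means with probability tending to $1$ as $n\to\infty$. For a graph $G$, $M(G)$ is the minimum size of a family of balls $B(u,s)=\{w:d_G(u,w)\le s\}$ (of arbitrary centers and radii) such that for any two distinct vertices $x,y$ some ball in the family contains exactly one of $x,y$ (equivalently, the minimum number of non-adaptive ball queries that determine any unknown vertex). $\log$ is base 2 and $\ln$ is the natural logarithm.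
   Formalization: The function d(n) is taken to be integer-valued (it plays the role of the diameter); for non-integer d the claim fails, e.g. d = 3.5 and p = n^(-0.7), where M is at most about n^0.1 ln n while the stated lower bound is about 4 n^0.25. *)

(* Defs.v *)
From mathcomp Require Import all_boot all_order all_algebra.
From mathcomp Require Import all_classical all_reals all_analysis.

Set Implicit Arguments.
Unset Strict Implicit.
Unset Printing Implicit Defensive.

Import Order.TTheory GRing.Theory Num.Theory.
Import numFieldNormedType.Exports.

Local Open Scope ring_scope.

Definition vpairs (n : nat) : {set {set 'I_n}} := [set e : {set 'I_n} | #|e| == 2%N].

(* A simple graph on the vertex set 'I_n is given by its set of edges. *)
Definition sgraph (n : nat) : Type :=
  {E : {set {set 'I_n}} | E \subset vpairs n}.

Definition adj (n : nat) (G : sgraph n) : rel 'I_n :=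
  [rel u v | [set u; v] \in sval G].

Definition walk (n : nat) (G : sgraph n) (u w : 'I_n) (k : nat) : bool :=
  [exists q : k.-tuple 'I_n, path (adj G) u q && (last u q == w)].

(* None is the infinite distance between vertices of distinct components. *)
Definition gdist (n : nat) (G : sgraph n) (u w : 'I_n) : option nat :=
  if pselect (exists k, walk G u w k) is left uw
  then Some (ex_minn uw) else None.

Definition gball (n : nat) (G : sgraph n) (u : 'I_n) (s : nat) : {set 'I_n} :=
  [set w | if gdist G u w is Some k then (k <= s)%N else false].

(* A family of balls is a list of (center, radius) pairs. *)
Definition separating (n : nat) (G : sgraph n) (F : seq ('I_n * nat)) : Prop :=
  forall x y : 'I_n, x != y ->
    exists2 b, b \in F & (x \in gball G b.1 b.2) != (y \in gball G b.1 b.2).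

Lemma gball0 (n : nat) (G : sgraph n) (u w : 'I_n) :
  (w \in gball G u 0) = (w == u).
Proof.
rewrite inE /gdist; case: pselect => [uw|nuw].
- case: ex_minnP => m wm minm; rewrite leqn0.
  apply/eqP/eqP => [m0|wu].
  + move: wm; rewrite m0 => /existsP[q]; rewrite tuple0 /=.
    by move=> /eqP.
  + apply/eqP; rewrite -leqn0; apply: minm; apply/existsP.
    by exists [tuple]; rewrite /= wu.
- apply/esym/negP => /eqP wu; apply: nuw; exists 0%N; apply/existsP.
  by exists [tuple]; rewrite /= wu.
Qed.

Lemma separating_exists (n : nat) (G : sgraph n) :
  exists m, `[< exists2 F, separating G F & size F = m >].
Proof.
exists (size [seq (u, 0%N) | u <- enum 'I_n]); apply/asboolP.
exists [seq (u, 0%N) | u <- enum 'I_n] => // x y xy.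
exists (x, 0%N); first by apply: map_f; rewrite mem_enum.
by rewrite /= !gball0 eqxx (eq_sym y) (negbTE xy).
Qed.

Definition ball_number (n : nat) (G : sgraph n) : nat :=
  ex_minn (separating_exists G).

Definition gnp_prob (R : realType) (n : nat) (p : R) (A : pred (sgraph n)) : R :=
  \sum_(G : sgraph n | A G)
    \prod_(e in vpairs n) (if e \in sval G then p else 1 - p).

Definition log2 (R : realType) (x : R) : R := ln x / ln 2.

(* Main.v *)
Require Import Defs.
From mathcomp Require Import all_boot all_order all_algebra.
From mathcomp Require Import all_classical all_reals all_analysis.
From mathcomp Require Import ring lra.

(* Write D = np, tau = D^(d-1)/n -> 0 and eps^2 = 24 ln n / D, so that d * eps -> 0: the
   hypotheses force D >= K (log n)^3 for every K, and d <= log n. A Chernoff bound for the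
   vertex boundary of a set A fails with probability at most n^(-3|A|), which beats the number
   of sets of size |A|; hence with high probability every set A expands by a factor
   (1 +- eps) D, up to a loss 2p|A|, and no breadth-first exploration is needed. Likewise any
   two disjoint sets of size about D^(d-1) are joined by an edge. Iterating the expansion,
   balls of radius d-1 have size at most (1+o(1)) D^(d-1), the union of two of them has size at
   least (2-o(1)) D^(d-1), and balls of radius d miss at most D^(d-1) vertices.
   Upper bound: two balls of radius d-1 have a symmetric difference of size (2-o(1)) D^(d-1),
   so some centre separates a fraction 2(1-o(1)) tau of the pairs that are still unseparated,
   and (1+o(1)) ln n / tau greedy choices separate all pairs.
   Lower bound: every ball or its complement has size at most (1+o(1)) D^(d-1), so each query
   reveals at most about tau log(1/tau) bits. *)

Import Order.TTheory GRing.Theory Num.Theory.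
Import numFieldNormedType.Exports.

Set Implicit Arguments.
Unset Strict Implicit.
Unset Printing Implicit Defensive.

Local Open Scope ring_scope.

(** * Means over the random graph *)

(** Outside D the first term is replaced by 0 and the second by 1: the expansion over all subsets of
    the index type then loses every J not contained in D and is otherwise unchanged. With D the set
    of vertex pairs, the subsets J are exactly the graphs. *)
Lemma prodrD_subset (R : comPzRingType) (I : finType) (D : {set I}) (F G : I -> R) :
  \prod_(i in D) (F i + G i) =
  \sum_(J : {set I} | J \subset D) \prod_(i in D) (if i \in J then F i else G i).
Proof.
pose F' i := if i \in D then F i else 0.
pose G' i := if i \in D then G i else 1.
transitivity (\prod_i (F' i + G' i)).
  rewrite [RHS](bigID (mem D)) /= [X in _ * X]big1 ?mulr1; last first.
    by move=> i /negbTE iD; rewrite /F' /G' iD add0r.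
  by apply: eq_bigr => i iD; rewrite /F' /G' iD.
rewrite bigA_distr /= (bigID [pred J : {set I} | J \subset D]) /=.
rewrite [X in _ + X]big1 ?addr0; last first.
  move=> J /fintype.subsetPn[i iJ iD].
  by rewrite (bigD1 i) //= iJ /F' (negbTE iD) mul0r.
apply: eq_bigr => J JD.
rewrite (bigID (mem D)) /= [X in _ * X]big1 ?mulr1; last first.
  move=> i iD; rewrite /G' (negbTE iD) ifF //.
  by apply/negbTE; apply: contra iD; move/(fintype.subsetP JD).
by apply: eq_bigr => i iD; rewrite /F' /G' iD.
Qed.

Definition gnp_weight (R : realType) (n : nat) (p : R) (G : sgraph n) : R :=
  \prod_(e in vpairs n) (if e \in sval G then p else 1 - p).

Definition gnp_mean (R : realType) (n : nat) (p : R) (X : sgraph n -> R) : R :=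
  \sum_(G : sgraph n) gnp_weight p G * X G.

Lemma gnp_weight_ge0 (R : realType) (n : nat) (p : R) (G : sgraph n) :
  0 <= p <= 1 -> 0 <= gnp_weight p G.
Proof.
by move=> /andP[p0 p1]; apply: prodr_ge0 => e _; case: ifP; rewrite ?subr_ge0.
Qed.

(** Independence of the edges: multiplying out the right-hand side chooses, for each pair, whether
    it is an edge, and so lists the graphs with their weights. *)
Lemma gnp_mean_prod (R : realType) (n : nat) (p : R)
    (f : {set 'I_n} -> bool -> R) :
  gnp_mean p (fun G => \prod_(e in vpairs n) f e (e \in sval G)) =
  \prod_(e in vpairs n) (p * f e true + (1 - p) * f e false).
Proof.
rewrite prodrD_subset /gnp_mean /gnp_weight.
under eq_bigr => G _ do rewrite -big_split /=.
rewrite [RHS]big_sub /=.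
by apply: eq_bigr => G _; apply: eq_bigr => e _; case: ifP.
Qed.

Definition cut (n : nat) (A B : {set 'I_n}) : {set {set 'I_n}} :=
  [set [set z.1; z.2] | z in finset.setX A B].

(** Disjointness makes each [[set u; v]] a genuine pair and recovers u and v from it, so the edges
    of the cut are indexed without repetition by A times B. *)
Lemma prod_cut (R : comPzRingType) (n : nat) (A B : {set 'I_n})
    (c : {set 'I_n} -> R) :
  [disjoint A & B] ->
  \prod_(e in vpairs n) (if e \in cut A B then c e else 1) =
  \prod_(u in A) \prod_(v in B) c [set u; v].
Proof.
move=> dAB.
have neq u v : u \in A -> v \in B -> u != v.
  by move=> uA vB; apply: contraTneq vB => <-; rewrite (disjointFr dAB).
rewrite -big_mkcondr /=.
rewrite (eq_bigl (mem (cut A B))); last first.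
  move=> e; rewrite andb_idl // => /imsetP[[u v] /finset.setXP[/= uA vB] ->].
  by rewrite inE cards2 neq.
rewrite [LHS]big_imset /=; last first.
  move=> [u v] [u' v'] /finset.setXP[/= uA vB] /finset.setXP[/= u'A v'B] /finset.setP E.
  have := E u; rewrite !inE eqxx /= (negbTE (neq _ _ uA v'B)) orbF => /esym/eqP ->.
  have := E v; rewrite !inE eqxx orbT.
  by rewrite eq_sym (negbTE (neq _ _ u'A vB)) => /esym/eqP ->.
rewrite pair_big /=.
by apply: eq_bigl => z; rewrite inE.
Qed.

Lemma gnp_mean_cut (R : realType) (n : nat) (p : R) (A B : {set 'I_n})
    (f : bool -> R) :
  [disjoint A & B] ->
  gnp_mean p (fun G : sgraph n => \prod_(u in A) \prod_(v in B) f (adj G u v)) =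
  (p * f true + (1 - p) * f false) ^+ (#|A| * #|B|).
Proof.
(* Pairs outside the cut get the factor 1, whose mean is [p + (1 - p) = 1]. *)
move=> dAB; pose h e b := if e \in cut A B then f b else 1.
transitivity (gnp_mean p (fun G : sgraph n =>
    \prod_(e in vpairs n) h e (e \in sval G))).
  apply: eq_bigr => G _; congr (_ * _); rewrite /h.
  by rewrite (prod_cut (fun e => f (e \in sval G)) dAB).
rewrite gnp_mean_prod /h.
rewrite (eq_bigr (fun e => if e \in cut A B then p * f true + (1 - p) * f false else 1));
  last by move=> e _; case: ifP => _ //; ring.
rewrite (prod_cut (fun=> _) dAB).
by under eq_bigr do rewrite prodr_const; rewrite prodr_const -exprM mulnC.
Qed.

Lemma gnp_weight_sum (R : realType) (n : nat) (p : R) :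
  \sum_(G : sgraph n) gnp_weight p G = 1.
Proof.
transitivity (gnp_mean p (fun G : sgraph n =>
    \prod_(e in vpairs n) (fun _ _ => 1) e (e \in sval G))).
  by apply: eq_bigr => G _; rewrite big1 ?mulr1.
by rewrite (gnp_mean_prod p (fun _ _ => 1)) big1 // => e _; ring.
Qed.

Lemma gnp_probE (R : realType) (n : nat) (p : R) (A : pred (sgraph n)) :
  gnp_prob p A = gnp_mean p (fun G => (A G)%:R).
Proof.
rewrite /gnp_prob big_mkcond; apply: eq_bigr => G _.
by case: (A G); rewrite ?mulr1 ?mulr0.
Qed.

Lemma gnp_mean_le (R : realType) (n : nat) (p : R) (X Y : sgraph n -> R) :
  0 <= p <= 1 -> (forall G, X G <= Y G) -> gnp_mean p X <= gnp_mean p Y.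
Proof.
by move=> p01 XY; apply: ler_sum => G _; apply: ler_wpM2l; rewrite ?gnp_weight_ge0.
Qed.

Lemma gnp_prob_le1 (R : realType) (n : nat) (p : R) (A : pred (sgraph n)) :
  0 <= p <= 1 -> gnp_prob p A <= 1.
Proof.
move=> p01; rewrite gnp_probE -[leRHS](gnp_weight_sum n p).
apply: ler_sum => G _; rewrite -[leRHS]mulr1.
by apply: ler_wpM2l; [exact: gnp_weight_ge0 | by case: (A G); rewrite ?ler01].
Qed.

(** Markov's inequality: X dominates the indicator of the failure of A. Taking for X a sum of
    exponential moments and indicators gives union bounds and Chernoff bounds at once. *)
Lemma gnp_prob_ge_bad (R : realType) (n : nat) (p : R) (A : pred (sgraph n))
    (X : sgraph n -> R) :
  0 <= p <= 1 -> (forall G, 0 <= X G) -> (forall G, ~~ A G -> 1 <= X G) ->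
  1 - gnp_mean p X <= gnp_prob p A.
Proof.
move=> p01 X0 X1; rewrite gnp_probE -[X in X - _](gnp_weight_sum n p) -sumrB.
apply: ler_sum => G _; rewrite -[X in X - _]mulr1 -mulrBr.
apply: ler_wpM2l; first exact: gnp_weight_ge0.
by case: (boolP (A G)) => [_|/X1]; [rewrite gerBl | rewrite subr_le0].
Qed.

(** * Vertex boundaries of arbitrary sets *)

(** From [expR t <= (1 - t)^-1] and (1 - t)(1 + t + 2t^2) = 1 + t^2 (1 - 2t), which is at least 1
    for t up to 1/2. *)
Lemma expR_le_quad2 (R : realType) (t : R) :
  0 <= t <= 1 / 2 -> expR t <= 1 + t + 2 * t ^+ 2.
Proof.
move=> /andP[t0 t1]; have t1' : 0 < 1 - t by lra.
have E : expR t <= (1 - t)^-1.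
  by rewrite -[t in leLHS]opprK expRN lef_pV2 ?posrE ?expR_gt0 // expR_ge1Dx.
apply: (le_trans E); rewrite -[leLHS]mul1r ler_pdivrMr //; nra.
Qed.

(** From [expR (- t) <= (1 + t)^-1] and (1 + t)(1 - t + t^2) = 1 + t^3. *)
Lemma expRN_le_quad (R : realType) (t : R) :
  0 <= t -> expR (- t) <= 1 - t + t ^+ 2.
Proof.
move=> t0; have t1' : 0 < 1 + t by lra.
have E : expR (- t) <= (1 + t)^-1.
  by rewrite expRN lef_pV2 ?posrE ?expR_gt0 // expR_ge1Dx.
apply: (le_trans E); rewrite -[leLHS]mul1r ler_pdivrMr //.
have : 0 <= t ^+ 3 by exact: exprn_ge0.
by rewrite !exprS expr0; nra.
Qed.

Lemma exprn_le_expR (R : realType) (y : R) (m : nat) :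
  0 <= 1 + y -> (1 + y) ^+ m <= expR (y * m%:R).
Proof. by move=> y1; rewrite expRM_natr lerXn2r ?nnegrE ?expR_ge0 ?expR_ge1Dx. Qed.

Definition closed_nbhd (n : nat) (G : sgraph n) (A : {set 'I_n}) : {set 'I_n} :=
  [set v | (v \in A) || [exists u in A, adj G u v]].

Definition bdry (n : nat) (G : sgraph n) (A : {set 'I_n}) : {set 'I_n} :=
  closed_nbhd G A :\: A.

Lemma in_bdry (n : nat) (G : sgraph n) (A : {set 'I_n}) (v : 'I_n) :
  (v \in bdry G A) = (v \in ~: A) && [exists u in A, adj G u v].
Proof. by rewrite !inE; case: (v \in A). Qed.

Lemma disjoint_compl (n : nat) (A T : {set 'I_n}) :
  T \subset ~: A -> [disjoint A & T].
Proof. by rewrite disjoint_sym => TA; rewrite finset.disjoints_subset. Qed.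

Lemma card_compl_real (R : realType) (n : nat) (A : {set 'I_n}) :
  #|~: A|%:R = n%:R - #|A|%:R :> R.
Proof.
by apply/eqP; rewrite eq_sym subr_eq -natrD addnC cardsC card_ord.
Qed.

(** The boundary is no larger than the number of edges leaving A, and that number is a sum of
    independent indicators with an explicit exponential moment. *)
Lemma gnp_mean_bdry_upper (R : realType) (n : nat) (p t : R) (A : {set 'I_n}) :
  0 <= p <= 1 -> 0 <= t <= 1 / 2 ->
  gnp_mean p (fun G : sgraph n => expR (t * #|bdry G A|%:R)) <=
  expR ((t + 2 * t ^+ 2) * (#|A|%:R * (n%:R * p))).
Proof.
move=> p01 t01; have [p0 p1] := andP p01; have [t0 t1] := andP t01.
have et1 : 1 <= expR t by rewrite -expR0 ler_expR.
have dA : [disjoint A & ~: A] by exact: disjoint_compl.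
pose f b := if b then expR t else 1.
apply: (@le_trans _ _ (gnp_mean p (fun G : sgraph n =>
    \prod_(u in A) \prod_(v in ~: A) f (adj G u v)))).
  apply: gnp_mean_le => // G; rewrite exchange_big /=.
  rewrite expRM_natr -prodr_const.
  rewrite (eq_bigl (fun v => (v \in ~: A) && [exists u in A, adj G u v]));
    last by move=> v; exact: in_bdry.
  rewrite big_mkcondr /=; apply: ler_prod => v vA; apply/andP; split.
    by case: ifP; rewrite ?expR_ge0.
  have f1 b : 1 <= f b by case: b.
  case: ifP => [/existsP[u /andP[uA uv]]|_]; last first.
    by elim/big_ind : _ => // a b a1 b1; exact: mulr_ege1.
  rewrite (bigD1 u) //= [X in X * _]/f uv -[leLHS]mulr1.
  apply: ler_wpM2l; first exact: expR_ge0.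
  by elim/big_ind : _ => // a b a1 b1; exact: mulr_ege1.
rewrite gnp_mean_cut // /f mulr1.
have -> : p * expR t + (1 - p) = 1 + p * (expR t - 1) by ring.
apply: (le_trans (exprn_le_expR _ _)); first by nra.
rewrite ler_expR natrM card_compl_real.
have := expR_le_quad2 t01; set q := 2 * t ^+ 2 => eq.
have q0 : 0 <= t + q by rewrite /q addr_ge0 // mulr_ge0 // sqr_ge0.
rewrite (_ : _ * (#|A|%:R * (n%:R * p)) = p * (t + q) * (#|A|%:R * n%:R)); last by ring.
apply: ler_pM.
- by rewrite mulr_ge0 // subr_ge0.
- by rewrite mulr_ge0 ?ler0n // subr_ge0 ler_nat -[leqRHS]card_ord max_card.
- by apply: ler_wpM2l => //; lra.
- by apply: ler_wpM2l => //; rewrite gerBl ler0n.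
Qed.

Lemma gnp_mean_no_edge (R : realType) (n : nat) (p : R) (A B : {set 'I_n}) :
  0 <= p <= 1 -> [disjoint A & B] ->
  gnp_mean p (fun G : sgraph n => [forall u in A, forall v in B, ~~ adj G u v]%:R) =
  (1 - p) ^+ (#|A| * #|B|).
Proof.
move=> p01 dAB.
have := @gnp_mean_cut R n p A B (fun b => (~~ b)%:R) dAB.
rewrite mulr0 add0r mulr1 => <-; apply: eq_bigr => G _; congr (_ * _).
case: forallP => [H|/forallP].
  rewrite big1 // => u uA; rewrite big1 // => v vB.
  by move: (H u); rewrite uA => /forallP/(_ v); rewrite vB /= => ->.
move=> /forallPn[u]; rewrite negb_imply => /andP[uA /forallPn[v]].
rewrite negb_imply negbK => /andP[vB uv].
by rewrite (bigD1 u) //= (bigD1 v) //= uv !mul0r.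
Qed.

Lemma gnp_mean_no_edge_le (R : realType) (n : nat) (p : R) (A B : {set 'I_n}) :
  0 <= p <= 1 -> [disjoint A & B] ->
  gnp_mean p (fun G : sgraph n => [forall u in A, forall v in B, ~~ adj G u v]%:R) <=
  expR (- p * (#|A|%:R * #|B|%:R)).
Proof.
move=> p01 dAB; rewrite gnp_mean_no_edge // -natrM.
by apply: exprn_le_expR; case/andP: p01; lra.
Qed.

Lemma prod_subset_mkcond (R : comPzRingType) (I : finType) (T D : {set I}) (F : I -> R) :
  T \subset D -> \prod_(i in T) F i = \prod_(i in D) (if i \in T then F i else 1).
Proof.
move=> TD; rewrite -big_mkcondr; apply: eq_bigl => i.
by rewrite andb_idl // => /(fintype.subsetP TD).
Qed.

(* Each vertex contributes [(1 - e^-t) * 1(no neighbour in A) + e^-t]; expanding over the set T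
   of vertices taking the first term leaves products of functions of single edges. *)
Lemma expRN_card_bdryE (R : realType) (n : nat) (t : R) (G : sgraph n) (A : {set 'I_n}) :
  expR (- t * #|bdry G A|%:R) =
  \sum_(T : {set 'I_n} | T \subset ~: A)
    (\prod_(v in ~: A) (if v \in T then 1 - expR (- t) else expR (- t))) *
    \prod_(u in A) \prod_(v in T) (~~ adj G u v)%:R.
Proof.
transitivity (\prod_(v in ~: A) ((1 - expR (- t)) * \prod_(u in A) (~~ adj G u v)%:R
   + expR (- t))).
  rewrite expRM_natr -prodr_const.
  rewrite (eq_bigl (fun v => (v \in ~: A) && [exists u in A, adj G u v]));
    last by move=> v; exact: in_bdry.
  rewrite big_mkcondr /=; apply: eq_bigr => v vA.
  case: existsP => [[u /andP[uA uv]]|H].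
    by rewrite (bigD1 u) //= uv mul0r mulr0 add0r.
  rewrite big1 => [|u uA]; first by rewrite mulr1 subrK.
  by case: (boolP (adj G u v)) => // uv; case: H; exists u; rewrite uA.
rewrite prodrD_subset; apply: eq_bigr => T TA.
rewrite exchange_big /= (prod_subset_mkcond _ TA) -big_split /=.
by apply: eq_bigr => v _; case: ifP => _ //; rewrite mulr1.
Qed.

Lemma gnp_mean_sum (R : realType) (n : nat) (p : R) (I : finType) (P : pred I)
    (X : I -> sgraph n -> R) :
  gnp_mean p (fun G => \sum_(i | P i) X i G) = \sum_(i | P i) gnp_mean p (X i).
Proof.
by rewrite /gnp_mean exchange_big /=; apply: eq_bigr => G _; rewrite mulr_sumr.
Qed.

Lemma gnp_meanZ (R : realType) (n : nat) (p c : R) (X : sgraph n -> R) :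
  gnp_mean p (fun G => c * X G) = c * gnp_mean p X.
Proof. by rewrite /gnp_mean mulr_sumr; apply: eq_bigr => G _; rewrite mulrCA. Qed.

Lemma gnp_meanD (R : realType) (n : nat) (p : R) (X Y : sgraph n -> R) :
  gnp_mean p (fun G => X G + Y G) = gnp_mean p X + gnp_mean p Y.
Proof. by rewrite /gnp_mean -big_split; apply: eq_bigr => G _; rewrite mulrDr. Qed.

(** Counting edges does not bound the boundary from below, so the moment is computed exactly: the
    vertices outside A enter the boundary independently, each with probability
    [1 - (1 - p) ^+ #|A|]. *)
Lemma gnp_mean_bdry_lowerE (R : realType) (n : nat) (p t : R) (A : {set 'I_n}) :
  gnp_mean p (fun G : sgraph n => expR (- t * #|bdry G A|%:R)) =
  (1 - (1 - expR (- t)) * (1 - (1 - p) ^+ #|A|)) ^+ #|~: A|.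
Proof.
rewrite /gnp_mean; under eq_bigr do rewrite expRN_card_bdryE.
rewrite [LHS](gnp_mean_sum p _ (fun (T : {set 'I_n}) (G : sgraph n) =>
  (\prod_(v in ~: A) (if v \in T then 1 - expR (- t) else expR (- t))) *
    \prod_(u in A) \prod_(v in T) (~~ adj G u v)%:R)).
transitivity (\prod_(v in ~: A) ((1 - expR (- t)) * (1 - p) ^+ #|A| + expR (- t))).
  rewrite prodrD_subset; apply: eq_bigr => T TA; rewrite gnp_meanZ.
  rewrite (@gnp_mean_cut R n p A T (fun b => (~~ b)%:R)); last exact: disjoint_compl.
  rewrite mulr0 add0r mulr1 exprM -prodr_const.
  rewrite (prod_subset_mkcond _ TA) -big_split /=.
  by apply: eq_bigr => v _; case: ifP => _ //; rewrite mulr1.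
by rewrite prodr_const; congr (_ ^+ _); ring.
Qed.

(** With a = |A|, a vertex outside A has a neighbour in A with probability at least ap(1 - ap), and
    there are n - a >= n(1 - ap) such vertices; the two losses combine to 1 - 2ap. *)
Lemma gnp_mean_bdry_lower (R : realType) (n : nat) (p t : R) (A : {set 'I_n}) :
  0 <= p <= 1 -> 0 <= t <= 1 -> 1 <= n%:R * p -> #|A|%:R * p <= 1 ->
  gnp_mean p (fun G : sgraph n => expR (- t * #|bdry G A|%:R)) <=
  expR (- (t - t ^+ 2) * (#|A|%:R * (n%:R * p) * (1 - 2 * (#|A|%:R * p)))).
Proof.
move=> p01 t01 D1 Ap; have [p0 p1] := andP p01; have [t0 t1] := andP t01.
rewrite gnp_mean_bdry_lowerE; set a : R := #|A|%:R.
have a0 : 0 <= a by rewrite ler0n.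
have ap0 : 0 <= a * p by rewrite mulr_ge0.
have c1 : t - t ^+ 2 <= 1 - expR (- t) by have := expRN_le_quad t0; lra.
have c0 : 0 <= 1 - expR (- t) by rewrite subr_ge0 expR_le1; lra.
have cle : 1 - expR (- t) <= 1 by have := expR_ge0 (- t); lra.
have q1 : a * p * (1 - a * p) <= 1 - (1 - p) ^+ #|A|.
  have := exprn_le_expR #|A| (y := - p); rewrite -/a => /(_ _) E.
  have := expRN_le_quad ap0; rewrite [a * p]mulrC -mulNr => E'.
  have := E ltac:(lra); lra.
have q0 : 0 <= 1 - (1 - p) ^+ #|A| by rewrite subr_ge0 exprn_ile1 //; lra.
have qle : 1 - (1 - p) ^+ #|A| <= 1 by rewrite gerBl exprn_ge0; lra.
set c := 1 - expR (- t) in c1 c0 cle *.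
set q := 1 - (1 - p) ^+ #|A| in q1 q0 qle *.
apply: (le_trans (exprn_le_expR _ _)); first by nra.
rewrite ler_expR card_compl_real -/a !mulNr lerN2.
(* Here [1 <= n%:R * p] is what gives a <= n a p. *)
have na : n%:R * (1 - a * p) <= n%:R - a by nra.
have n0 : 0 <= n%:R :> R by [].
have t2 : 0 <= t - t ^+ 2 by nra.
apply: (@le_trans _ _ ((t - t ^+ 2) * ((a * p * (1 - a * p)) * (n%:R * (1 - a * p))))).
  apply: ler_wpM2l => //.
  have -> : a * p * (1 - a * p) * (n%:R * (1 - a * p)) =
    a * (n%:R * p) * (1 - 2 * (a * p)) + a * (n%:R * p) * (a * p) ^+ 2 by ring.
  by rewrite lerDl !mulr_ge0 ?sqr_ge0.
rewrite -[leRHS]mulrA; apply: ler_pM => //.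
  by rewrite !mulr_ge0 ?subr_ge0.
by apply: ler_pM => //; rewrite ?mulr_ge0 ?subr_ge0.
Qed.

Lemma sum_exprn_card (R : comPzRingType) (n : nat) (x : R) :
  \sum_(A : {set 'I_n}) x ^+ #|A| = (1 + x) ^+ n.
Proof.
transitivity (\prod_(i in [set: 'I_n]) (x + 1)); last first.
  by rewrite prodr_const cardsT card_ord addrC.
rewrite prodrD_subset; apply: eq_big => [A|A _]; first by rewrite finset.subsetT.
by rewrite -prodr_const (prod_subset_mkcond _ (finset.subsetT A)).
Qed.

Lemma sum_exprn_card_neq0 (R : realType) (n : nat) (x : R) :
  0 <= x ->
  \sum_(A : {set 'I_n} | A != finset.set0) x ^+ #|A| <= expR (x * n%:R) - 1.
Proof.
move=> x0; have := sum_exprn_card n x; rewrite (bigD1 finset.set0) //= cards0 expr0 => E.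
rewrite -(lerD2l 1) E addrCA subrr addr0.
by apply: exprn_le_expR; lra.
Qed.

(** * Expanding graphs and the union bound over all vertex sets *)

Definition expands_atmost (R : realType) (n : nat) (p eps : R) (G : sgraph n) : bool :=
  [forall A : {set 'I_n}, (A != finset.set0) ==>
    (#|bdry G A|%:R <= (1 + eps) * (#|A|%:R * (n%:R * p)))].

(** The factor 1 - 2p|A| pays for shared neighbours and for the vertices of A itself. The cap 1/4
    keeps it at least 1/2, so the Chernoff exponent stays proportional to |A|np. *)
Definition expands_atleast (R : realType) (n : nat) (p eps : R) (G : sgraph n) : bool :=
  [forall A : {set 'I_n}, (A != finset.set0) && (#|A|%:R * p <= 1 / 4) ==>
    ((1 - eps) * (#|A|%:R * (n%:R * p) * (1 - 2 * (#|A|%:R * p))) <= #|bdry G A|%:R)].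

Definition joined (R : realType) (n : nat) (m : R) (G : sgraph n) : bool :=
  [forall A : {set 'I_n}, forall B : {set 'I_n},
    [&& [disjoint A & B], m <= #|A|%:R & m <= #|B|%:R] ==>
    ~~ [forall u in A, forall v in B, ~~ adj G u v]].

Definition expanding_graph (R : realType) (n : nat) (p eps m : R) (G : sgraph n) : bool :=
  [&& expands_atmost p eps G, expands_atleast p eps G & joined m G].

Lemma ge1_sum_nonneg (R : realType) (I : finType) (P : pred I) (F : I -> R) (i : I) :
  (forall j, 0 <= F j) -> P i -> 1 <= F i -> 1 <= \sum_(j | P j) F j.
Proof.
move=> F0 Pi Fi; rewrite (bigD1 i) //=; apply: (le_trans Fi).
by rewrite lerDl sumr_ge0.
Qed.

Lemma card_real_gt0 (R : realType) (n : nat) (A : {set 'I_n}) :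
  A != finset.set0 -> 1 <= #|A|%:R :> R.
Proof. by rewrite -finset.card_gt0 (ler1n R). Qed.

(* Union bound over all sets: with [x = n ^ (- 5 / 4)], a given A violates either expansion with
   probability at most [x ^ |A|] (Chernoff at eps / 4 and eps / 2), a pair A, B lacks edges with
   probability at most [x ^ (|A| + |B|)], and [s = e^(n x) - 1] bounds the sum of the [x ^ |A|]. *)
Lemma gnp_prob_expanding (R : realType) (n : nat) (p eps m : R)
    (s := expR (expR (- (5 / 4) * ln n%:R) * n%:R) - 1) :
  0 <= p <= 1 -> 1 <= n%:R * p -> 0 <= eps <= 1 -> (0 < n)%N ->
  24 * ln n%:R <= (n%:R * p) * eps ^+ 2 ->
  0 < m -> 5 / 2 * ln n%:R <= p * m ->
  1 - (2 * s + s ^+ 2) <= gnp_prob p (@expanding_graph R n p eps m).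
Proof.
move=> p01 D1 eps01 n0 hD m0 hm.
have [p0 p1] := andP p01; have [e0 e1] := andP eps01.
pose l : R := ln n%:R; pose x := expR (- (5 / 4) * l); rewrite -/l in hD hm s *.
have l0 : 0 <= l by rewrite ln_ge0 // ler1n.
have x0 : 0 <= x by exact: expR_ge0.
pose S : R := \sum_(A : {set 'I_n} | A != finset.set0) x ^+ #|A|.
have S0 : 0 <= S by apply: sumr_ge0 => A _; exact: exprn_ge0.
have Ss : S <= s by exact: sum_exprn_card_neq0.
have xA (A : {set 'I_n}) y : y <= - (5 / 4) * l * #|A|%:R -> expR y <= x ^+ #|A|.
  by move=> yA; rewrite -expRM_natr ler_expR.
pose D := n%:R * p; rewrite -/D in D1 hD.
pose U (A : {set 'I_n}) (G : sgraph n) : R :=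
  expR (- (eps / 4 * (1 + eps) * (#|A|%:R * D))) * expR (eps / 4 * #|bdry G A|%:R).
pose nu (A : {set 'I_n}) := #|A|%:R * D * (1 - 2 * (#|A|%:R * p)).
pose L (A : {set 'I_n}) (G : sgraph n) : R :=
  expR (eps / 2 * (1 - eps) * nu A) * expR (- (eps / 2) * #|bdry G A|%:R).
pose J (z : {set 'I_n} * {set 'I_n}) (G : sgraph n) : R :=
  [forall u in z.1, forall v in z.2, ~~ adj G u v]%:R.
pose PU (A : {set 'I_n}) := A != finset.set0.
pose PL (A : {set 'I_n}) := (A != finset.set0) && (#|A|%:R * p <= 1 / 4).
pose PJ (z : {set 'I_n} * {set 'I_n}) :=
  [&& [disjoint z.1 & z.2], m <= #|z.1|%:R & m <= #|z.2|%:R].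
pose X G := \sum_(A | PU A) U A G + \sum_(A | PL A) L A G + \sum_(z | PJ z) J z G.
have U0 A G : 0 <= U A G by rewrite mulr_ge0 ?expR_ge0.
have L0 A G : 0 <= L A G by rewrite mulr_ge0 ?expR_ge0.
have J0 A G : 0 <= J A G by rewrite ler0n.
have sU G : 0 <= \sum_(A | PU A) U A G by exact: sumr_ge0.
have sL G : 0 <= \sum_(A | PL A) L A G by exact: sumr_ge0.
have sJ G : 0 <= \sum_(z | PJ z) J z G by exact: sumr_ge0.
have X0 G : 0 <= X G by rewrite !addr_ge0.
have X1 G : ~~ expanding_graph p eps m G -> 1 <= X G.
  rewrite !negb_and => /or3P[/forallPn[A]|/forallPn[A]|/forallPn[A /forallPn[B]]].
  - rewrite negb_imply -ltNge => /andP[A0 bA].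
    have : 1 <= \sum_(A | PU A) U A G.
      apply: (@ge1_sum_nonneg _ _ _ _ A) => //.
      rewrite /U -expRD -[leLHS]expR0 ler_expR.
      by rewrite addrC subr_ge0 -mulrA ler_wpM2l ?divr_ge0 // ltW.
    by have := sL G; have := sJ G; rewrite /X; lra.
  - rewrite negb_imply -ltNge => /andP[A0 bA].
    have : 1 <= \sum_(A | PL A) L A G.
      apply: (@ge1_sum_nonneg _ _ _ _ A) => //.
      rewrite /L -expRD -[leLHS]expR0 ler_expR.
      by rewrite mulNr subr_ge0 -mulrA ler_wpM2l ?divr_ge0 // ltW.
    by have := sU G; have := sJ G; rewrite /X; lra.
  - rewrite negb_imply negbK => /andP[AB noE].
    have : 1 <= \sum_(z | PJ z) J z G.
      by apply: (@ge1_sum_nonneg _ _ _ _ (A, B)) => //; rewrite /J /= noE.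
    by have := sU G; have := sL G; rewrite /X; lra.
apply: le_trans (gnp_prob_ge_bad p01 X0 X1); rewrite lerD2l lerN2.
rewrite !gnp_meanD !gnp_mean_sum.
have BU : \sum_(A | PU A) gnp_mean p (U A) <= S.
  apply: ler_sum => A A0; rewrite gnp_meanZ.
  have t01 : 0 <= eps / 4 <= 1 / 2 by lra.
  have := gnp_mean_bdry_upper A p01 t01; rewrite -/D => B.
  apply: le_trans (ler_wpM2l (expR_ge0 _) B) _; rewrite -expRD; apply: xA.
  have a1 := card_real_gt0 R A0.
  (* At t = eps/4 the exponents add up to -(eps^2 / 8) |A| D, which is at most -3 l |A|. *)
  have : 24 * l * #|A|%:R <= D * eps ^+ 2 * #|A|%:R by rewrite ler_wpM2r.
  have : 0 <= l * #|A|%:R by rewrite mulr_ge0.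
  lra.
have BL : \sum_(A | PL A) gnp_mean p (L A) <= S.
  rewrite /S [leRHS](bigID (fun A : {set 'I_n} => #|A|%:R * p <= 1 / 4)) /= -[leLHS]addr0.
  apply: lerD; last by apply: sumr_ge0 => A _; exact: exprn_ge0.
  apply: ler_sum => A /andP[A0 Ap]; rewrite gnp_meanZ.
  have t01 : 0 <= eps / 2 <= 1 by lra.
  have Ap1 : #|A|%:R * p <= 1 by lra.
  have := gnp_mean_bdry_lower p01 t01 D1 Ap1; rewrite -/D => B.
  apply: le_trans (ler_wpM2l (expR_ge0 _) B) _; rewrite -expRD; apply: xA.
  have a1 := card_real_gt0 R A0; rewrite -/(nu A).
  (* At t = eps/2 the exponents add up to -(eps^2 / 4) [nu A]; the cap on |A| p makes this at most
     -(eps^2 / 8) |A| D, hence again at most -3 l |A|. *)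
  have nuA : #|A|%:R * D * (1 / 2) <= nu A.
    by rewrite /nu ler_wpM2l ?mulr_ge0 //; lra.
  have : 24 * l * #|A|%:R <= D * eps ^+ 2 * #|A|%:R by rewrite ler_wpM2r.
  have : eps ^+ 2 * (#|A|%:R * D * (1 / 2)) <= eps ^+ 2 * nu A.
    by rewrite ler_wpM2l ?sqr_ge0.
  have : 0 <= l * #|A|%:R by rewrite mulr_ge0.
  lra.
have BJ : \sum_(z | PJ z) gnp_mean p (J z) <= S ^+ 2.
  rewrite expr2 /S mulr_suml; under [leRHS]eq_bigr do rewrite mulr_sumr.
  rewrite [leRHS]pair_big /=.
  rewrite [leRHS](bigID PJ) /= -[leLHS]addr0.
  apply: lerD; last by apply: sumr_ge0 => z _; rewrite mulr_ge0 ?exprn_ge0.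
  (* Since [0 < m], the pairs in [PJ] consist of nonempty sets and hence occur in the expansion of
     [S ^+ 2]. *)
  rewrite [leRHS](eq_bigl PJ); last first.
    move=> [A B] /=; rewrite andb_idl // => /and3P[_ /= mA mB].
    rewrite -!finset.card_gt0 -!(ltr0n R).
    by rewrite !(lt_le_trans m0).
  apply: ler_sum => -[A B] /and3P[/= dAB mA mB].
  apply: (le_trans (gnp_mean_no_edge_le p01 dAB)).
  rewrite -!expRM_natr -expRD ler_expR -/l.
  set a : R := #|A|%:R in mA *; set b : R := #|B|%:R in mB *.
  (* As a and b are both at least m, the exponent satisfies pab >= pm(a + b)/2 >= (5/4) l (a + b),
     so the failure probability splits into one power of x for each set. *)
  have h1 : m * (a + b) <= 2 * (a * b) by nra.
  have h2 : p * (m * (a + b)) <= p * (2 * (a * b)) by rewrite ler_wpM2l.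
  have h3 : 5 / 2 * l * (a + b) <= p * m * (a + b).
    by rewrite ler_wpM2r // addr_ge0.
  lra.
have : S ^+ 2 <= s ^+ 2 by rewrite lerXn2r ?nnegrE // (le_trans S0).
lra.
Qed.

(** * Balls in an expanding graph *)

Lemma walkP (n : nat) (G : sgraph n) (u w : 'I_n) (k : nat) :
  reflect (exists q, [/\ size q = k, path (adj G) u q & last u q = w]) (walk G u w k).
Proof.
apply: (iffP existsP) => [[q /andP[uq /eqP qw]]|[q [qk uq qw]]].
  by exists q; rewrite size_tuple.
by rewrite -qk; exists (in_tuple q); rewrite uq qw eqxx.
Qed.

Lemma adj_sym (n : nat) (G : sgraph n) (u v : 'I_n) : adj G u v = adj G v u.
Proof. by rewrite /adj /= finset.setUC. Qed.

Lemma walk_sym (n : nat) (G : sgraph n) (u w : 'I_n) (k : nat) :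
  walk G u w k = walk G w u k.
Proof.
suff imp x y : walk G x y k -> walk G y x k by apply/idP/idP; exact: imp.
move=> /walkP[q [qk xq qy]]; apply/walkP; exists (rev (belast x q)); split.
- by rewrite size_rev size_belast.
- rewrite -qy rev_path; apply: (@sub_path _ (adj G) _ _ _ _ xq) => a b ab.
  by rewrite -/(adj G b a) adj_sym.
- by case: q {qk xq} qy => [|a q] //= _; rewrite rev_cons last_rcons.
Qed.

Lemma walkS (n : nat) (G : sgraph n) (u w : 'I_n) (k : nat) :
  walk G u w k.+1 = [exists v, walk G u v k && adj G v w].
Proof.
apply/walkP/existsP => [[q [qk uq qw]]|[v /andP[/walkP[q [qk uq qv]] vw]]].
  case/lastP: q qk uq qw => [|q b] //; rewrite size_rcons rcons_path last_rcons.
  move=> [qk] /andP[uq qb] <-; exists (last u q).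
  by rewrite qb andbT; apply/walkP; exists q.
exists (rcons q w); split; first by rewrite size_rcons qk.
  by rewrite rcons_path uq qv.
by rewrite last_rcons.
Qed.

Lemma in_gball (n : nat) (G : sgraph n) (u w : 'I_n) (s : nat) :
  reflect (exists2 k, (k <= s)%N & walk G u w k) (w \in gball G u s).
Proof.
rewrite inE /gdist; apply: (iffP idP).
  by case: pselect => // uw; case: ex_minnP => m wm _ ms; exists m.
move=> [k ks wk]; case: pselect => [uw|[]]; last by exists k.
by case: ex_minnP => m _ /(_ _ wk) mk; exact: leq_trans mk ks.
Qed.

Lemma gball_sym (n : nat) (G : sgraph n) (u w : 'I_n) (s : nat) :
  (w \in gball G u s) = (u \in gball G w s).
Proof. by apply/in_gball/in_gball => -[k ks wk]; exists k => //; rewrite walk_sym. Qed.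

Lemma gball_mono (n : nat) (G : sgraph n) (u : 'I_n) (s t : nat) :
  (s <= t)%N -> gball G u s \subset gball G u t.
Proof.
move=> st; apply/fintype.subsetP => w /in_gball[k ks wk]; apply/in_gball.
by exists k => //; exact: leq_trans ks st.
Qed.

Definition reach (n : nat) (G : sgraph n) (k : nat) (A : {set 'I_n}) : {set 'I_n} :=
  iter k (closed_nbhd G) A.

Lemma gball_reach (n : nat) (G : sgraph n) (u : 'I_n) (s : nat) :
  gball G u s = reach G s [set u].
Proof.
elim: s => [|s IH]; apply/finset.setP => w; first by rewrite gball0 /= inE.
rewrite /= [RHS]inE -/(reach G s [set u]) -IH.
apply/in_gball/orP => [[k ks wk]|].
  case: k ks wk => [|k] ks wk; first by left; apply/in_gball; exists 0%N.
  move: wk; rewrite walkS => /existsP[v /andP[uv vw]]; right.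
  by apply/existsP; exists v; rewrite vw andbT; apply/in_gball; exists k.
case=> [/in_gball[k ks wk]|/existsP[v /andP[/in_gball[k ks wk] vw]]].
  by exists k => //; exact: leqW.
by exists k.+1 => //; rewrite walkS; apply/existsP; exists v; rewrite wk.
Qed.

Lemma closed_nbhdU (n : nat) (G : sgraph n) (A B : {set 'I_n}) :
  closed_nbhd G (A :|: B) = closed_nbhd G A :|: closed_nbhd G B.
Proof.
apply/finset.setP => v; rewrite !inE.
have -> : [exists u in A :|: B, adj G u v] =
    [exists u in A, adj G u v] || [exists u in B, adj G u v].
  apply/existsP/orP => [[u]|[|] /existsP[u /andP[uA uv]]].
  - by rewrite inE => /andP[/orP[uA|uA] uv]; [left|right];
      apply/existsP; exists u; rewrite uA.
  - by exists u; rewrite inE uA.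
  - by exists u; rewrite inE uA orbT.
by rewrite orbACA.
Qed.

(** Because of this, the union of two balls is the [reach] of the pair of centres, and expansion
    bounds it without a separate estimate of the intersection. *)
Lemma reachU (n : nat) (G : sgraph n) (k : nat) (A B : {set 'I_n}) :
  reach G k (A :|: B) = reach G k A :|: reach G k B.
Proof. by elim: k => //= k ->; rewrite closed_nbhdU. Qed.

Lemma sub_closed_nbhd (n : nat) (G : sgraph n) (A : {set 'I_n}) : A \subset closed_nbhd G A.
Proof. by apply/fintype.subsetP => v vA; rewrite inE vA. Qed.

Lemma card_closed_nbhd (n : nat) (G : sgraph n) (A : {set 'I_n}) :
  #|closed_nbhd G A| = (#|A| + #|bdry G A|)%N.
Proof. by rewrite -(cardsID A) (finset.setIidPr (sub_closed_nbhd G A)). Qed.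

Lemma reach_neq0 (n : nat) (G : sgraph n) (k : nat) (A : {set 'I_n}) :
  A != finset.set0 -> reach G k A != finset.set0.
Proof.
move=> A0; elim: k => //= k; apply: contraNneq => E.
by rewrite -finset.subset0 -E sub_closed_nbhd.
Qed.

(** One step multiplies the size by at most 1 + (1 + eps) D; the 1 for the set itself is absorbed by
    eps D, which leaves (1 + 2 eps) D. *)
Lemma card_reach_le (R : realType) (n : nat) (p eps : R) (G : sgraph n)
    (A : {set 'I_n}) (k : nat) :
  expands_atmost p eps G -> 0 <= eps -> 1 <= eps * (n%:R * p) -> A != finset.set0 ->
  #|reach G k A|%:R <= #|A|%:R * ((n%:R * p) * (1 + 2 * eps)) ^+ k.
Proof.
move=> /forallP up e0 De A0; set D := n%:R * p in De *.
have D0 : 0 <= D by nra.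
elim: k => [|k IH]; first by rewrite expr0 mulr1.
rewrite /= card_closed_nbhd natrD.
have := up (reach G k A); rewrite reach_neq0 // implyTb -/D => h.
rewrite exprSr mulrA.
apply: (@le_trans _ _ (#|reach G k A|%:R * (D * (1 + 2 * eps)))); last first.
  by rewrite ler_wpM2r // mulr_ge0 // addr_ge0 // mulr_ge0.
have : 0 <= #|reach G k A|%:R :> R by [].
set a : R := #|reach G k A|%:R in h *; nra.
Qed.

(** By the upper bound on [reach], the loss factor of step k is at least 1 - 8 D^(k+1) / n. Before
    the last step this quotient is at most tau / D, and 8 tau / D <= eps, so each early step still
    gains (1 - 2 eps) D; only the last step pays the full 8 tau. *)
Lemma card_reach_ge (R : realType) (n : nat) (p eps tau : R) (G : sgraph n)
    (A : {set 'I_n}) (r : nat) (D := n%:R * p) :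
  expands_atmost p eps G -> expands_atleast p eps G ->
  (0 < n)%N -> 0 <= p -> 0 <= eps <= 1 / 2 -> 1 <= D -> 1 <= eps * D ->
  (1 + 2 * eps) ^+ r.+1 <= 2 -> D ^+ r.+1 / n%:R = tau -> tau <= 1 / 16 ->
  A != finset.set0 -> (#|A| <= 2)%N ->
  #|A|%:R * D ^+ r.+1 * ((1 - 2 * eps) ^+ r.+1 * (1 - 8 * tau)) <= #|reach G r.+1 A|%:R.
Proof.
move=> up low n0 p0 e01 D1 eD e2 tauE tau16 A0 A2; have [e0 e1] := andP e01.
have D0 : 0 < D by lra.
have nR : 0 < n%:R :> R by rewrite ltr0n.
have tau0 : 0 <= tau by rewrite -tauE divr_ge0 // exprn_ge0 // ltW.
have A2R : #|A|%:R <= 2 :> R by rewrite ler_nat.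
have small k : (k <= r)%N -> #|reach G k A|%:R * p <= 4 * (D ^+ k.+1 / n%:R).
  move=> kr; rewrite (_ : _ / _ = D ^+ k * p); last first.
    by rewrite exprSr /D; field; rewrite gt_eqF.
  rewrite mulrA ler_wpM2r //.
  apply: (le_trans (card_reach_le k up e0 eD A0)); rewrite -/D exprMn.
  have E2 : (1 + 2 * eps) ^+ k <= 2.
    by apply: le_trans e2; rewrite ler_weXn2l ?lerDl ?mulr_ge0 //; exact: leqW.
  have E0 : 0 <= (1 + 2 * eps) ^+ k by rewrite exprn_ge0 // addr_ge0 // mulr_ge0.
  have Dk : 0 <= D ^+ k by rewrite exprn_ge0 // ltW.
  rewrite (_ : 4 * D ^+ k = 2 * (D ^+ k * 2)); last by ring.
  by apply: ler_pM => //; rewrite ?mulr_ge0 // ler_wpM2l.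
have small1 k : (k <= r)%N -> D ^+ k.+1 / n%:R <= tau.
  by move=> kr; rewrite -tauE ler_wpM2r ?invr_ge0 // ler_weXn2l.
have step k c : (k <= r)%N -> D ^+ k.+1 / n%:R <= c -> c <= tau ->
    #|reach G k A|%:R * D * ((1 - eps) * (1 - 8 * c)) <= #|reach G k.+1 A|%:R.
  move=> kr kc ct; have sk := small _ kr.
  have /implyP := forallP low (reach G k A).
  rewrite reach_neq0 //= -/D => /(_ _) h.
  (* The size condition of [expands_atleast] holds because 4 tau <= 1/4. *)
  have {}h := h ltac:(lra).
  rewrite card_closed_nbhd natrD; apply: le_trans (le_trans h _); last by rewrite lerDr.
  rewrite [leRHS](_ : _ = #|reach G k A|%:R * D *
    ((1 - eps) * (1 - 2 * (#|reach G k A|%:R * p)))); last by ring.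
  apply: ler_wpM2l; first by rewrite mulr_ge0 // ltW.
  apply: ler_wpM2l; lra.
have ind k : (k <= r)%N -> #|A|%:R * D ^+ k * (1 - 2 * eps) ^+ k <= #|reach G k A|%:R.
  elim: k => [|k IH] kr; first by rewrite !expr0 !mulr1.
  have kr' : (k <= r)%N by exact: ltnW.
  have tD : D ^+ k.+1 / n%:R <= tau / D.
    rewrite (_ : tau / D = D ^+ r / n%:R); last first.
      by rewrite -tauE exprSr; field; rewrite !gt_eqF.
    by rewrite ler_wpM2r ?invr_ge0 // ler_weXn2l.
  have tD1 : tau / D <= tau by rewrite ler_pdivrMr // -[leLHS]mulr1 ler_wpM2l.
  apply: le_trans (step k (tau / D) kr' tD tD1).
  have tDe : 8 * (tau / D) <= eps.
    rewrite mulrA ler_pdivrMr //; lra.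
  rewrite [leLHS](_ : _ =
      #|A|%:R * D ^+ k * (1 - 2 * eps) ^+ k * (D * (1 - 2 * eps))); last first.
    by rewrite !exprSr; ring.
  rewrite -[leRHS]mulrA; apply: ler_pM => //; last 2 first.
  - exact: IH.
  - apply: ler_wpM2l; first exact: ltW.
    apply: (@le_trans _ _ ((1 - eps) * (1 - eps))); first by have := sqr_ge0 eps; lra.
    by rewrite ler_wpM2l //; lra.
  - by rewrite !mulr_ge0 ?exprn_ge0 //; lra.
  - by rewrite mulr_ge0 //; lra.
apply: le_trans (step r tau (leqnn r) (small1 r (leqnn r)) (lexx tau)).
rewrite [leLHS](_ : _ = #|A|%:R * D ^+ r * (1 - 2 * eps) ^+ r *
   (D * ((1 - 2 * eps) * (1 - 8 * tau)))); last by rewrite !exprSr; ring.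
rewrite -[leRHS]mulrA; apply: ler_pM; last 2 first.
- exact: ind.
- by apply: ler_wpM2l; [exact: ltW | apply: ler_wpM2r; lra].
- by rewrite !mulr_ge0 ?exprn_ge0 //; lra.
- by rewrite !mulr_ge0 //; lra.
Qed.

Lemma bernoulli_le (R : realType) (x : R) (k : nat) :
  0 <= x <= 1 -> 1 - k%:R * x <= (1 - x) ^+ k.
Proof.
move=> /andP[x0 x1]; elim: k => [|k IH]; first by rewrite mul0r subr0 expr0.
rewrite exprSr -natr1; apply: (@le_trans _ _ ((1 - k%:R * x) * (1 - x))).
  have : 0 <= k%:R * x ^+ 2 by rewrite mulr_ge0 // sqr_ge0.
  lra.
by apply: ler_wpM2r => //; lra.
Qed.

(** Here [r.+1] stands for d - 1, and [delta] is the error accumulated over that many steps: (1 + 2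
    eps)^(r+1) <= e^delta and (1 - 2 eps)^(r+1) >= 1 - delta. *)
Lemma expanding_balls (R : realType) (n : nat) (p eps m tau : R) (G : sgraph n)
    (r : nat) (D := n%:R * p) (delta := 2 * r.+1%:R * eps) :
  expanding_graph p eps m G ->
  (0 < n)%N -> 0 <= p -> 0 <= eps -> 1 <= D -> 1 <= eps * D ->
  D ^+ r.+1 / n%:R = tau -> tau <= 1 / 16 -> delta <= 1 -> expR delta <= 2 ->
  m <= D ^+ r.+1 * ((1 - delta) * (1 - 8 * tau)) ->
  [/\ forall x, #|gball G x r.+1|%:R <= expR delta * D ^+ r.+1,
      forall x y, x != y ->
        2 * ((1 - delta) * (1 - 8 * tau)) * D ^+ r.+1 <=
        #|gball G x r.+1 :|: gball G y r.+1|%:R &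
      forall x, #|~: gball G x r.+2|%:R <= D ^+ r.+1].
Proof.
move=> /and3P[up low jn] n0 p0 e0 D1 eD tauE tau16 d1 u2 hm.
have nR : 0 < n%:R :> R by rewrite ltr0n.
have DD : 0 <= D ^+ r.+1 by rewrite exprn_ge0 //; lra.
have tau0 : 0 <= tau by rewrite -tauE divr_ge0 // ltW.
have d2 : 2 * eps <= delta.
  rewrite /delta mulrAC ler_peMr ?mulr_ge0 //.
  by rewrite ler1n.
have d0 : 0 <= delta by lra.
have e01 : 0 <= eps <= 1 / 2 by lra.
have e2 : (1 + 2 * eps) ^+ r.+1 <= expR delta.
  rewrite (_ : delta = 2 * eps * r.+1%:R); last by rewrite /delta; ring.
  by apply: exprn_le_expR; lra.
have e3 : 1 - delta <= (1 - 2 * eps) ^+ r.+1.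
  rewrite (_ : delta = r.+1%:R * (2 * eps)); last by rewrite /delta; ring.
  by apply: bernoulli_le; lra.
have lower (A : {set 'I_n}) : A != finset.set0 -> (#|A| <= 2)%N ->
    #|A|%:R * ((1 - delta) * (1 - 8 * tau)) * D ^+ r.+1 <= #|reach G r.+1 A|%:R.
  move=> A0 A2; have := card_reach_ge up low n0 p0 e01 D1 eD
    (le_trans e2 u2) tauE tau16 A0 A2.
  apply: le_trans; rewrite -/D mulrAC; apply: ler_wpM2l; first by rewrite mulr_ge0.
  by apply: ler_wpM2r => //; lra.
have x0 (x : 'I_n) : [set x] != finset.set0 by rewrite -finset.card_gt0 cards1.
split=> [x|x y xy|x].
- rewrite gball_reach; apply: (le_trans (card_reach_le _ up e0 eD (x0 x))).
  by rewrite cards1 mul1r -/D exprMn mulrC ler_wpM2r.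
- rewrite !gball_reach -reachU.
  have c2 : #|[set x] :|: [set y]| = 2%N by rewrite cards2 xy.
  have := lower ([set x] :|: [set y]); rewrite c2; apply => //.
  by rewrite -finset.card_gt0 c2.
(* No edge runs from the ball of radius r+1 to the complement of the ball of radius r+2. Were that
   complement too large, both sets would have size at least m, against [joined]. *)
- rewrite leNgt; apply/negP => big.
  have lx := lower _ (x0 x); rewrite cards1 mul1r in lx.
  rewrite mulrC in hm; have mA := le_trans hm (lx isT).
  have mB : m <= #|~: gball G x r.+2|%:R.
    apply: ltW; apply: le_lt_trans hm _; apply: le_lt_trans big.
    by rewrite ler_piMl //; nra.
  have := forallP (forallP jn (reach G r.+1 [set x])) (~: gball G x r.+2).
  rewrite mA mB !andbT => /implyP => H.
  suff /H/negP : [disjoint reach G r.+1 [set x] & ~: gball G x r.+2].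
    apply; apply/forallP => u; apply/implyP => uA; apply/forallP => v.
    apply/implyP; rewrite inE gball_reach /= -/(reach _ _ _); apply: contra => uv.
    by rewrite inE; apply/orP; right; apply/existsP; exists u; rewrite uA.
  apply: disjoint_compl; rewrite finset.setCS gball_reach; exact: sub_closed_nbhd.
Qed.

(** * Separating families *)

Lemma sum_card_sections (I J : finType) (P : {set J}) (sep : I -> J -> bool) :
  (\sum_i #|[set j in P | sep i j]| = \sum_(j in P) #|[set i | sep i j]|)%N.
Proof.
under eq_bigr => i _ do rewrite -sum1_card.
under [RHS]eq_bigr => j _ do rewrite -sum1_card.
rewrite [RHS](exchange_big_dep predT) //=; apply: eq_bigr => i _.
by apply: eq_bigl => j; rewrite !inE.
Qed.

(** Double counting: every remaining j is separated by a fraction c of I, so on average, and hence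
    for some i, a fraction c of the remaining j is separated. *)
Lemma greedy_cover (R : realType) (I J : finType) (sep : I -> J -> bool) (c : R)
    (P : {set J}) :
  0 <= c <= 1 -> (0 < #|I|)%N ->
  (forall j, j \in P -> c * #|I|%:R <= #|[set i | sep i j]|%:R) ->
  forall k, exists2 F : seq I, size F = k &
    #|[set j in P | ~~ has (sep^~ j) F]|%:R <= (1 - c) ^+ k * #|P|%:R.
Proof.
move=> /andP[c0 c1] I0 many; elim=> [|k [F Fk IH]].
  exists [::] => //; rewrite expr0 mul1r ler_nat.
  by apply: subset_leq_card; apply/fintype.subsetP => j; rewrite inE => /andP[].
set Q := [set j in P | _] in IH *.
have [i hi] : exists i, c * #|Q|%:R <= #|[set j in Q | sep i j]|%:R.
  apply/existsP; apply: contraT => /existsPn H.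
  have /card_gt0P[i0 _] := I0.
  have : \sum_(i : I) #|[set j in Q | sep i j]|%:R < \sum_(i : I) c * #|Q|%:R.
    apply: ltr_sum => [|i _]; last by rewrite ltNge H.
    by apply/hasP; exists i0; rewrite ?mem_index_enum.
  rewrite ltNge => /negP[].
  rewrite -natr_sum sum_card_sections natr_sum.
  apply: (@le_trans _ _ (\sum_(j in Q) c * #|I|%:R)).
    by rewrite !sumr_const -[leLHS]mulr_natr -[leRHS]mulr_natr mulrAC.
  by apply: ler_sum => j; rewrite inE => /andP[jP _]; exact: many.
exists (i :: F); first by rewrite /= Fk.
have -> : [set j in P | ~~ has (sep^~ j) (i :: F)] = Q :\: [set j in Q | sep i j].
  by apply/finset.setP => j; rewrite !inE /= negb_or; case: (sep i j); case: (j \in P);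
    case: has.
rewrite cardsDS; last by apply/fintype.subsetP => j; rewrite inE => /andP[].
rewrite natrB; last first.
  by apply: subset_leq_card; apply/fintype.subsetP => j; rewrite inE => /andP[].
rewrite exprS -mulrA; apply: (@le_trans _ _ ((1 - c) * #|Q|%:R)); first lra.
by apply: ler_wpM2l => //; lra.
Qed.

(** Greedy choice of centres at the fixed radius r: after k choices at most e^(-ck) n^2 < 1 ordered
    pairs remain, hence none. *)
Lemma ball_number_le (R : realType) (n r k : nat) (G : sgraph n) (c : R) :
  0 <= c <= 1 -> (0 < n)%N ->
  (forall x y, x != y -> c * n%:R <=
     2 * #|gball G x r :|: gball G y r|%:R - #|gball G x r|%:R - #|gball G y r|%:R) ->
  2 * ln n%:R < c * k%:R -> (ball_number G <= k)%N.
Proof.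
move=> c01 n0 sym ck; have [c0 c1] := andP c01.
have nR : 0 < n%:R :> R by rewrite ltr0n.
pose P : {set 'I_n * 'I_n} := [set z | z.1 != z.2].
pose sep (u : 'I_n) (z : 'I_n * 'I_n) := (z.1 \in gball G u r) != (z.2 \in gball G u r).
have many z : z \in P -> c * #|'I_n|%:R <= #|[set u | sep u z]|%:R.
  case: z => x y; rewrite inE /= => xy; rewrite card_ord; apply: le_trans (sym x y xy) _.
  set A := gball G x r; set B := gball G y r.
  (* By symmetry of the distance, the centres that separate x from y form the symmetric difference
     of the balls around x and y. *)
  have -> : [set u | sep u (x, y)] = (A :|: B) :\: (A :&: B).
    apply/finset.setP => u; rewrite finset.in_setD finset.in_setI finset.in_setU [LHS]inE.
    rewrite /sep /= ![_ \in gball G u r]gball_sym -/A -/B.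
    by case: (u \in A); case: (u \in B).
  have IU : A :&: B \subset A :|: B.
    by apply: fintype.subset_trans (finset.subsetIl _ _) (finset.subsetUl _ _).
  rewrite cardsDS // natrB ?subset_leq_card //.
  have := cardsUI A B => /(congr1 (fun i => i%:R : R)); rewrite !natrD; lra.
have n0' : (0 < #|'I_n|)%N by rewrite card_ord.
have [F Fk] := greedy_cover c01 n0' many k.
set Q := [set _ in P | _] => Q1.
have Q0 : Q = finset.set0.
  apply/finset.cards0_eq/eqP; rewrite -leqn0 -ltnS -(ltr_nat R).
  apply: le_lt_trans Q1 _.
  have cP : #|P|%:R <= n%:R ^+ 2 :> R.
    by rewrite -natrX ler_nat (leq_trans (max_card _)) // card_prod card_ord.
  apply: (@le_lt_trans _ _ (expR (- c * k%:R) * n%:R ^+ 2)).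
    apply: ler_pM => //; first by rewrite exprn_ge0 //; lra.
    by apply: exprn_le_expR; lra.
  rewrite -[X in _ * X ^+ 2]lnK ?posrE // -expRM_natr -expRD expR_lt1; lra.
have sF : separating G [seq (u, r) | u <- F].
  move=> x y xy; have := finset.in_set0 (x, y); rewrite -Q0 !inE xy /= => /negbFE/hasP[u uF s].
  by exists (u, r) => //; exact: map_f.
rewrite /ball_number; case: ex_minnP => k' _; apply; apply/asboolP.
by exists [seq (u, r) | u <- F] => //; rewrite size_map.
Qed.

(* Give the vertices weight [x ^ |code|]: the codes are distinct, so the total weight is at
   most [(1 + x) ^ M], while convexity bounds it below by [n x ^ (M x)]. *)
Lemma separating_sets_count (R : realType) (n M : nat) (S : 'I_M -> {set 'I_n}) (x : R) :
  0 < x <= 1 -> (0 < n)%N -> (forall i, #|S i|%:R <= x * n%:R) ->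
  (forall u v, u != v -> exists i, (u \in S i) != (v \in S i)) ->
  ln n%:R <= M%:R * (x * (1 - ln x)).
Proof.
move=> /andP[x0 x1] n0 Sx sepS.
have nR : 0 < n%:R :> R by rewrite ltr0n.
pose code (v : 'I_n) := [set i | v \in S i].
have code_inj : injective code.
  move=> u v E; apply/eqP; apply: contraT => /sepS[i].
  by have /finset.setP/(_ i) := E; rewrite !inE => ->; rewrite eqxx.
have up : \sum_(v : 'I_n) x ^+ #|code v| <= expR (x * M%:R).
  apply: (@le_trans _ _ (\sum_(C : {set 'I_M}) x ^+ #|C|)); last first.
    by rewrite sum_exprn_card; apply: exprn_le_expR; lra.
  rewrite -(big_imset (fun C : {set 'I_M} => x ^+ #|C|) (A := predT)) /=;
    last by move=> u v _ _; exact: code_inj.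
  rewrite [leRHS](bigID (mem [set code v | v in predT])) /= lerDl.
  by apply: sumr_ge0 => C _; rewrite exprn_ge0 // ltW.
have lx : ln x <= 0 by exact: ln_le0.
(* A lower bound for the mean over v of |code v| ln x: the codes have total size at most M x n, and
   ln x <= 0. The convexity used is the tangent line of the exponential at t. *)
pose t := M%:R * x * ln x.
have low : n%:R * expR t <= \sum_(v : 'I_n) x ^+ #|code v|.
  apply: (@le_trans _ _ (\sum_(v : 'I_n) expR t * (1 + (#|code v|%:R * ln x - t)))).
    rewrite -mulr_sumr mulrC; apply: ler_wpM2l; first exact: expR_ge0.
    rewrite big_split sumr_const card_ord /= -[leLHS]addr0 lerD2l sumrB -mulr_suml.
    rewrite sumr_const card_ord subr_ge0 -mulr_natr -natr_sum.
    rewrite (_ : t * n%:R = M%:R * (x * n%:R) * ln x); last by rewrite /t; ring.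
    have -> : (\sum_v #|code v| = \sum_i #|S i|)%N.
      under eq_bigr => v _ do rewrite -sum1_card.
      under [RHS]eq_bigr => i _ do rewrite -sum1_card.
      rewrite [RHS](exchange_big_dep predT) //=; apply: eq_bigr => v _.
      by apply: eq_bigl => i; rewrite !inE.
    apply: ler_wnM2r => //; rewrite natr_sum.
    apply: (@le_trans _ _ (\sum_(i < M) x * n%:R)); first exact: ler_sum.
    by rewrite sumr_const card_ord -[leLHS]mulr_natl.
  apply: ler_sum => v _; rewrite -[X in _ <= X ^+ _]lnK ?posrE // -expRM_natl.
  rewrite -[in leRHS](subrKC t (_ * ln x)) expRD.
  by apply: ler_wpM2l; rewrite ?expR_ge0 ?expR_ge1Dx.
have := le_trans low up.
rewrite -[X in X * _]lnK ?posrE // -expRD ler_expR /t; lra.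
Qed.

(** A set and its complement separate the same pairs, so every ball of radius above r may be
    replaced by its complement, which is then small too. *)
Lemma ball_number_lower (R : realType) (n r : nat) (G : sgraph n) (x : R) :
  0 < x <= 1 -> (0 < n)%N ->
  (forall u, #|gball G u r|%:R <= x * n%:R) ->
  (forall u, #|~: gball G u r.+1|%:R <= x * n%:R) ->
  ln n%:R <= (ball_number G)%:R * (x * (1 - ln x)).
Proof.
move=> x01 n0 small big; rewrite /ball_number.
case: ex_minnP => k /asboolP[F sepF <-] _.
pose S (i : 'I_(size F)) := let b := tnth (in_tuple F) i in
  if (b.2 <= r)%N then gball G b.1 b.2 else ~: gball G b.1 b.2.
apply: (@separating_sets_count R n (size F) S) => // [i|u v /sepF[b bF uv]].
  rewrite /S /=; case: (tnth _ i) => y s /=; case: (leqP s r) => sr.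
    by apply: le_trans (small y); rewrite ler_nat subset_leq_card ?gball_mono.
  by apply: le_trans (big y); rewrite ler_nat subset_leq_card ?finset.setCS ?gball_mono.
have /tnthP[i bi] : b \in in_tuple F by [].
exists i; rewrite /S -bi /=; case: ifP => _ //.
by rewrite ![_ \in ~: _]finset.in_setC; apply: contra uv => /eqP/negb_inj ->.
Qed.

(** Two balls of radius r+1 differ in at least 2 sigma tau n vertices: twice the lower bound on
    their union minus the upper bounds on each. The threshold in [joined] is kept below the
    guaranteed size of a ball. *)
Lemma ball_number_expanding (R : realType) (n : nat) (p eps tau : R) (G : sgraph n)
    (r : nat) (D := n%:R * p) (delta := 2 * r.+1%:R * eps)
    (sigma := 2 * ((1 - delta) * (1 - 8 * tau)) - expR delta) :
  expanding_graph p eps (15 / 16 * D ^+ r.+1) G ->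
  (1 < n)%N -> 0 <= p -> 0 <= eps -> 1 <= D -> 1 <= eps * D ->
  D ^+ r.+1 / n%:R = tau -> tau <= 1 / 16 -> delta <= 1 -> expR delta <= 2 ->
  15 / 16 <= (1 - delta) * (1 - 8 * tau) -> 0 < sigma ->
  (expR delta * (1 + (ln (tau^-1))^-1))^-1 * (tau^-1 * (ln n%:R / ln (tau^-1)))
    <= (ball_number G)%:R <= ln n%:R / (sigma * tau) + 1.
Proof.
move=> reg n1 p0 e0 D1 eD tauE tau16 d1 u2 l15 s0.
have n0 : (0 < n)%N by exact: ltnW.
have nR : 0 < n%:R :> R by rewrite ltr0n.
have DD : 0 < D ^+ r.+1 by rewrite exprn_gt0 //; lra.
have tau0 : 0 < tau by rewrite -tauE divr_gt0.
have d0 : 0 <= delta by rewrite /delta !mulr_ge0.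
have DE : D ^+ r.+1 = tau * n%:R by rewrite -tauE divfK // gt_eqF.
have hm : 15 / 16 * D ^+ r.+1 <= D ^+ r.+1 * ((1 - delta) * (1 - 8 * tau)).
  by rewrite mulrC ler_pM2l.
have [b1 b2 b3] := expanding_balls reg n0 p0 e0 D1 eD tauE tau16 d1 u2 hm.
rewrite -/D -/delta DE in b1 b2 b3.
set u := expR delta in u2 b1 *.
have u1 : 1 <= u by rewrite -[leLHS]expR0 ler_expR.
set l := (1 - delta) * (1 - 8 * tau) in l15 b2.
have sigmaE : sigma = 2 * l - u by [].
have L0 : 0 < ln (tau^-1) by rewrite ln_gt0 // invf_gt1 //; lra.
have Lneg : ln tau = - ln (tau^-1) by rewrite lnV ?posrE // opprK.
have ln0 : 0 < ln n%:R :> R by rewrite ln_gt0 // ltr1n.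
apply/andP; split.
  have x01 : 0 < u * tau <= 1 by apply/andP; split; nra.
  have := @ball_number_lower R n r.+1 G (u * tau) x01 n0; rewrite -mulrA => h.
  have {}h := h b1 _.
  have {}h := h ltac:(by move=> y; apply: (le_trans (b3 y)); rewrite ler_peMl // ltW // -DE).
  rewrite lnM ?posrE ?expR_gt0 // expRK Lneg in h.
  set L := ln tau^-1 in L0 h *; set M : R := (ball_number G)%:R in h *.
  have M0 : 0 <= M by [].
  have {}h : ln n%:R <= M * (u * tau * (1 + L)).
    (* Here 1 - ln(u tau) = 1 - delta + L, which is at most 1 + L. *)
    by apply: (le_trans h); rewrite ler_wpM2l // ler_wpM2l; lra.
  have -> : (u * (1 + L^-1))^-1 * (tau^-1 * (ln n%:R / L)) =
      ln n%:R / (u * tau * (1 + L)).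
    by field; rewrite !gt_eqF //; lra.
  rewrite ler_pdivrMr // !mulr_gt0 //; lra.
pose y : R := ln n%:R / (sigma * tau).
have st0 : 0 < sigma * tau by rewrite mulr_gt0.
have y0 : 0 <= y by rewrite divr_ge0 // ltW.
have /andP[t1 t2] := truncn_itv y0.
(* The greedy bound needs strictly more than y choices; rounding costs the final + 1. *)
apply: (@le_trans _ _ (Num.truncn y).+1%:R); last by rewrite -natr1 lerD2r.
rewrite ler_nat; apply: (@ball_number_le R n r.+1 _ G (2 * (sigma * tau))) => //.
- have : l <= 1.
    rewrite /l; have : 0 <= 1 - delta by lra.
    have : 0 <= 1 - 8 * tau by lra.
    nra.
  move=> l1; have sle : sigma <= 2 by rewrite sigmaE; lra.
  by apply/andP; split; nra.
- move=> v w vw; have := b1 v; have := b1 w; have := b2 v w vw.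
  rewrite sigmaE; lra.
- by rewrite -mulrA ltr_pM2l // mulrC -ltr_pdivrMr.
Qed.

(** * Asymptotics *)

Local Open Scope classical_set_scope.

Lemma gnp_prob_mono (R : realType) (n : nat) (p : R) (A B : pred (sgraph n)) :
  0 <= p <= 1 -> (forall G, A G -> B G) -> gnp_prob p A <= gnp_prob p B.
Proof.
move=> p01 AB; rewrite !gnp_probE; apply: gnp_mean_le => // G.
by case: (boolP (A G)) => [/AB ->|]; rewrite // ler0n.
Qed.

(** Since e^(1/8) >= 9/8 and (9/8)^6 > 2. *)
Lemma ln2_le (R : realType) : ln 2 <= 3 / 4 :> R.
Proof.
rewrite -[leRHS]expRK ler_ln ?posrE ?expR_gt0 //.
have -> : 3 / 4 = (1 / 8) * 6%:R :> R by field.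
rewrite expRM_natr; apply: (@le_trans _ _ ((1 + 1 / 8) ^+ 6)).
  by rewrite !exprS expr0; lra.
by rewrite lerXn2r ?nnegrE ?expR_ge0 ?expR_ge1Dx //; lra.
Qed.

Lemma ln2_gt0 (R : realType) : 0 < ln 2 :> R.
Proof. by rewrite ln_gt0 // ltr1n. Qed.

Lemma cvg_ln_nat (R : realType) : (ln n%:R : R) @[n --> \oo] --> +oo.
Proof.
apply/cvgryPge => A; near=> n.
rewrite -[leLHS]expRK ler_ln ?posrE ?expR_gt0 //; last first.
  by rewrite ltr0n; near: n; exact: nbhs_infty_gt.
by near: n; exact: nbhs_infty_ger.
Unshelve. all: by end_near. Qed.

(** As (np)^d = n (p^d n^(d-1)) >= n, the logarithm of np is at least (log n) / d, which eventually
    exceeds 3 log log n + log K. *)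
Lemma mean_degree_ge (R : realType) (d : nat -> nat) (p : nat -> R)
    (hd : forall n, (3 < d n)%N) (hp : forall n, 0 < p n < 1)
    (hdiam : (log2 (n%:R : R) / (d n)%:R - 3 * log2 (log2 (n%:R : R)))
             @[n --> \oo] --> +oo)
    (hpd : (p n ^+ d n * n%:R ^+ (d n - 1) - 2 * log2 (n%:R : R))
             @[n --> \oo] --> +oo) (K : R) :
  0 < K -> \forall n \near \oo,
    K * log2 n%:R ^+ 3 <= n%:R * p n /\ (d n)%:R <= log2 (n%:R : R).
Proof.
move=> K0; near=> n.
have l2 := ln2_gt0 R.
have n2 : (2 <= n)%N by near: n; exact: nbhs_infty_ge.
have nR : 0 < n%:R :> R by rewrite ltr0n ltnW.
have lg1 : 1 <= log2 (n%:R : R).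
  by rewrite ler_pdivlMr // mul1r ler_ln ?posrE // ler_nat.
have llg0 : 0 <= log2 (log2 (n%:R : R)) by apply: divr_ge0; [exact: ln_ge0 | exact: ltW].
have dR : 0 < (d n)%:R :> R by rewrite ltr0n; apply: leq_ltn_trans (hd n).
have h1 : 1 <= log2 (n%:R : R) / (d n)%:R - 3 * log2 (log2 (n%:R : R)).
  by near: n; exact: (cvgryPge _).1.
have hK : ln K / ln 2 <= log2 (n%:R : R) / (d n)%:R - 3 * log2 (log2 (n%:R : R)).
  by near: n; exact: (cvgryPge _).1.
have hD : 0 <= p n ^+ d n * n%:R ^+ (d n - 1) - 2 * log2 (n%:R : R).
  by near: n; exact: (cvgryPge _).1.
have [p0 p1] := andP (hp n).
split; last first.
  have : 1 <= log2 (n%:R : R) / (d n)%:R by lra.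
  by rewrite ler_pdivlMr // mul1r.
have D0 : 0 < n%:R * p n by rewrite mulr_gt0.
have Dn : n%:R <= (n%:R * p n) ^+ d n.
  have -> : (n%:R * p n) ^+ d n = n%:R * (p n ^+ d n * n%:R ^+ (d n - 1)).
    rewrite exprMn mulrCA -exprS subn1 prednK 1?mulrC //.
    exact: leq_ltn_trans (hd n).
  by rewrite ler_peMr ?ltW //; lra.
have lD : ln n%:R / (d n)%:R <= ln (n%:R * p n).
  rewrite ler_pdivrMr // mulr_natr -lnXn // ler_ln ?posrE ?exprn_gt0 //.
have lg0 : 0 < log2 (n%:R : R) by lra.
have lg3 : 0 < log2 (n%:R : R) ^+ 3 by exact: exprn_gt0.
rewrite -ler_ln ?posrE //; last exact: mulr_gt0.
rewrite lnM ?posrE // lnXn //; apply: le_trans lD.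
have {}hK : ln K / ln 2 * ln 2 <=
   (log2 (n%:R : R) / (d n)%:R - 3 * log2 (log2 (n%:R : R))) * ln 2.
  by rewrite ler_wpM2r // ltW.
rewrite divfK ?gt_eqF // mulrBl -mulrA [_^-1 * _]mulrC mulrA in hK.
rewrite {1}/log2 divfK ?gt_eqF // -mulrA {1}/log2 divfK ?gt_eqF // in hK.
by rewrite -[ln (log2 _) *+ 3]mulr_natl; lra.
Unshelve. all: by end_near. Qed.

Definition chernoff_dev (R : realType) (p : nat -> R) (n : nat) : R :=
  Num.sqrt (24 * ln n%:R / (n%:R * p n)).

(** The square is 96 (d-1)^2 ln n / (np), at most 96 (log n)^3 / (np) because d <= log n; hence the
    cube in [mean_degree_ge] and the choice K = 96 / e^2. *)
Lemma chernoff_dev_cvg0 (R : realType) (d : nat -> nat) (p : nat -> R)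
    (hd : forall n, (3 < d n)%N) (hp : forall n, 0 < p n < 1)
    (hdiam : (log2 (n%:R : R) / (d n)%:R - 3 * log2 (log2 (n%:R : R)))
             @[n --> \oo] --> +oo)
    (hpd : (p n ^+ d n * n%:R ^+ (d n - 1) - 2 * log2 (n%:R : R))
             @[n --> \oo] --> +oo) :
  (2 * (d n - 1)%:R * chernoff_dev p n) @[n --> \oo] --> 0.
Proof.
apply/cvgr0Pnorm_le => e e0; have K0 : 0 < 96 / e ^+ 2 by rewrite divr_gt0 // exprn_gt0.
near=> n.
have l2 := ln2_gt0 R; have l21 := ln2_le R.
have n2 : (2 <= n)%N by near: n; exact: nbhs_infty_ge.
have nR : 0 < n%:R :> R by rewrite ltr0n ltnW.
have lg1 : 1 <= log2 (n%:R : R).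
  by rewrite ler_pdivlMr // mul1r ler_ln ?posrE // ler_nat.
have [hD hdl] : 96 / e ^+ 2 * log2 n%:R ^+ 3 <= n%:R * p n /\ (d n)%:R <= log2 (n%:R : R).
  by near: n; exact: (mean_degree_ge hd hp hdiam hpd K0).
have [p0 p1] := andP (hp n).
have D0 : 0 < n%:R * p n by rewrite mulr_gt0.
have dl : (d n - 1)%:R <= log2 (n%:R : R).
  by apply: le_trans hdl; rewrite ler_nat leq_subr.
have lnE : ln n%:R = log2 (n%:R : R) * ln 2 by rewrite divfK ?gt_eqF.
have lnle : ln n%:R <= log2 (n%:R : R) by rewrite lnE; nra.
have ln0 : 0 <= ln n%:R :> R by rewrite lnE mulr_ge0 // ltW //; lra.
rewrite ger0_norm; last by rewrite !mulr_ge0 // sqrtr_ge0.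
rewrite -(@ler_pXn2r R 2) ?nnegrE //; last 2 first.
- by rewrite !mulr_ge0 // sqrtr_ge0.
- exact: ltW.
rewrite exprMn sqr_sqrtr; last by apply: divr_ge0; [exact: mulr_ge0 | exact: ltW].
rewrite mulrA ler_pdivrMr //.
set g := log2 (n%:R : R) in lg1 hD dl lnle *.
have {}hD : 96 * g ^+ 3 <= e ^+ 2 * (n%:R * p n).
  rewrite [leRHS]mulrC -ler_pdivrMr ?exprn_gt0 //.
  by apply: le_trans hD; rewrite mulrAC.
apply: le_trans hD.
have -> : (2 * (d n - 1)%:R) ^+ 2 * (24 * ln n%:R) = 96 * ((d n - 1)%:R ^+ 2 * ln n%:R) :> R.
  by ring.
rewrite ler_pM2l // [leRHS]exprSr; apply: ler_pM => //.
by rewrite lerXn2r // nnegrE //; lra.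
Unshelve. all: by end_near. Qed.

Lemma ball_volume_cvg0 (R : realType) (d : nat -> nat) (p : nat -> R)
    (hp : forall n, 0 < p n < 1)
    (hball : (fun n : nat => (n%:R * p n) ^+ (d n - 1)) =o_\oo (fun n : nat => n%:R : R)) :
  ((n%:R * p n) ^+ (d n - 1) / n%:R) @[n --> \oo] --> (0 : R).
Proof.
apply/cvgr0Pnorm_le => e e0; near=> n.
have n0 : (0 < n)%N by near: n; exact: nbhs_infty_gt.
have nR : 0 < n%:R :> R by rewrite ltr0n.
have : `|(n%:R * p n) ^+ (d n - 1)| <= e * `|n%:R|.
  by near: n; move/eqoP : hball; apply.
by rewrite normrM normfV ler_pdivrMr // normr_gt0 gt_eqF.
Unshelve. all: by end_near. Qed.

(** The inner quantity n n^(-5/4) = n^(-1/4) tends to 0. *)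
Lemma failure_cvg0 (R : realType)
    (s := fun n : nat => expR (expR (- (5 / 4) * ln n%:R) * n%:R) - 1 : R) :
  (1 - (2 * s n + s n ^+ 2)) @[n --> \oo] --> (1 : R).
Proof.
have s0 : s n @[n --> \oo] --> (0 : R).
  have h0 : (expR (- (5 / 4) * ln n%:R) * n%:R : R) @[n --> \oo] --> (0 : R).
    apply/cvgr0Pnorm_le => e e0; near=> n.
    have nR : 0 < n%:R :> R by rewrite ltr0n; near: n; exact: nbhs_infty_gt.
    rewrite -[X in _ * X]lnK ?posrE // -expRD ger0_norm ?expR_ge0 //.
    rewrite -[leRHS]lnK ?posrE // ler_expR.
    have : - 4 * ln e <= ln n%:R.
      by near: n; exact: (cvgryPge _).1 (@cvg_ln_nat R) _.
    lra.
  rewrite [X in _ --> X](_ : _ = expR 0 - 1); last by rewrite expR0 subrr.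
  apply: cvgB; last exact: cvg_cst.
  by apply: continuous_cvg => //; exact: continuous_expR.
rewrite [X in _ --> X](_ : _ = 1 - (2 * 0 + 0 ^+ 2)); last by ring.
apply: cvgB; first exact: cvg_cst.
by apply: cvgD; [apply: cvgM => //; exact: cvg_cst | apply: cvgM].
Unshelve. all: by end_near. Qed.

Local Open Scope ring_scope.

Theorem theorem3p8 (R : realType) (d : nat -> nat) (p : nat -> R)
  (hd : forall n : nat, (3 < d n)%N)
  (hp : forall n : nat, 0 < p n < 1)
  (hdiam : (log2 (n%:R : R) / (d n)%:R - 3 * log2 (log2 (n%:R : R)))
             @[n --> \oo] --> +oo)
  (hpd : (p n ^+ d n * n%:R ^+ (d n - 1) - 2 * log2 (n%:R : R))
             @[n --> \oo] --> +oo)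
  (hball : (fun n : nat => (n%:R * p n) ^+ (d n - 1))
             =o_\oo (fun n : nat => n%:R : R)) :
  exists e1 e2 : nat -> R,
    [/\ e1 @ \oo --> 0,
        e2 @ \oo --> 0 &
        gnp_prob (p n) (fun G : sgraph n =>
          (1 - e1 n) * (n%:R / (n%:R * p n) ^+ (d n - 1)
             * (log2 (n%:R : R) / log2 (n%:R / (n%:R * p n) ^+ (d n - 1))))
          <= (ball_number G)%:R
          <= (1 + e2 n) * (n%:R / (n%:R * p n) ^+ (d n - 1) * ln n%:R))
        @[n --> \oo] --> (1 : R)].
Proof.
pose D n := n%:R * p n.
pose delta n := 2 * (d n - 1)%:R * chernoff_dev p n.
pose tau n := D n ^+ (d n - 1) / n%:R.
pose L n := ln (tau n)^-1.
pose l n : R := (1 - delta n) * (1 - 8 * tau n).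
pose sigma n : R := 2 * l n - expR (delta n).
have delta0 : delta @ \oo --> 0 := chernoff_dev_cvg0 hd hp hdiam hpd.
have tau0 : tau @ \oo --> 0 := ball_volume_cvg0 hp hball.
have u1 : expR (delta n) @[n --> \oo] --> (1 : R).
  by rewrite -[X in _ --> X]expR0; apply: continuous_cvg => //; exact: continuous_expR.
have l1 : l @ \oo --> (1 : R).
  rewrite [X in _ --> X](_ : _ = (1 - 0) * (1 - 8 * 0)); last by ring.
  apply: cvgM; apply: cvgB => //; first exact: cvg_cst.
    exact: cvg_cst.
  by apply: cvgM => //; exact: cvg_cst.
have sigma1 : sigma @ \oo --> (1 : R).
  rewrite [X in _ --> X](_ : _ = 2 * 1 - 1); last by ring.
  by apply: cvgB => //; apply: cvgM => //; exact: cvg_cst.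
have n_gt0 : \forall n \near \oo, 0 < n%:R :> R.
  by near=> n; rewrite ltr0n; near: n; exact: nbhs_infty_gt.
have tau_gt0 : \forall n \near \oo, 0 < tau n.
  near=> n; have nR : 0 < n%:R :> R by near: n.
  by have [p0 _] := andP (hp n); rewrite divr_gt0 // exprn_gt0 // mulr_gt0.
have Ly : L @ \oo --> +oo.
  apply/cvgryPge => A; near=> n.
  have t0 : 0 < tau n by near: n.
  have : `|tau n| <= expR (- A).
    by near: n; move/cvgr0Pnorm_le : tau0; apply; exact: expR_gt0.
  rewrite ger0_norm; last exact: ltW.
  move=> tA.
  rewrite -[leLHS]opprK /L lnV ?posrE // lerN2.
  by rewrite -[leRHS]expRK ler_ln ?posrE ?expR_gt0.
have LV0 : (L n)^-1 @[n --> \oo] --> (0 : R).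
  have L_gt0 : \forall n \near \oo, 0 < L n.
    by near=> n; near: n; exact: (cvgryPgt _).1 Ly _.
  exact: (gtr0_cvgV0 L_gt0).2 Ly.
have lnV0 : (ln n%:R : R)^-1 @[n --> \oo] --> (0 : R).
  have ln_gt0 : \forall n \near \oo, 0 < ln n%:R :> R.
    by near=> n; near: n; exact: (cvgryPgt _).1 (@cvg_ln_nat R) _.
  exact: (gtr0_cvgV0 ln_gt0).2 (@cvg_ln_nat R).
(* Both witnesses are solved from [ball_number_expanding], so that its two bounds become exactly the
   required ones; the term tau / ln n in the second comes from the rounding + 1. *)
exists (fun n => 1 - (expR (delta n) * (1 + (L n)^-1))^-1),
  (fun n => (sigma n)^-1 + tau n * (ln n%:R)^-1 - 1); split.
- rewrite [X in _ --> X](_ : _ = 1 - (1 * (1 + 0))^-1); last by rewrite addr0 mulr1 invr1 subrr.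
  apply: cvgB; first exact: cvg_cst.
  apply: cvgV; first by rewrite addr0 mulr1 oner_eq0.
  by apply: cvgM => //; apply: cvgD => //; exact: cvg_cst.
- rewrite [X in _ --> X](_ : _ = 1^-1 + 0 * 0 - 1 :> R); last by rewrite invr1 mulr0 addr0 subrr.
  apply: cvgB; last exact: cvg_cst.
  by apply: cvgD; [apply: cvgV => //; rewrite oner_eq0 | apply: cvgM].
pose s n : R := expR (expR (- (5 / 4) * ln n%:R) * n%:R) - 1.
apply: (@squeeze_cvgr _ _ _ R (fun n => 1 - (2 * s n + s n ^+ 2)) (fun=> 1));
  [near=> n | exact: failure_cvg0 | exact: cvg_cst].
have p01 : 0 <= p n <= 1 by have /andP[/ltW -> /ltW ->] := hp n.
rewrite gnp_prob_le1 // andbT.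
have [p0 p1] := andP (hp n).
have n1 : (1 < n)%N by near: n; exact: nbhs_infty_gt.
have n0 : (0 < n)%N by exact: ltnW.
have nR : 0 < n%:R :> R by rewrite ltr0n.
have t0 : 0 < tau n by near: n.
have t1 : tau n <= 1 / 16.
  have : `|tau n| <= 1 / 16.
    by near: n; move/cvgr0Pnorm_le : tau0; apply; rewrite divr_gt0.
  by rewrite ger0_norm // ltW.
have d1 : delta n <= 1.
  apply: le_trans (ler_norm _) _.
  by near: n; move/cvgr0Pnorm_le : delta0; apply.
have u2 : expR (delta n) <= 2.
  by near: n; apply: (cvgr_le 1) => //; rewrite ltr1n.
have l15 : 15 / 16 <= l n.
  by near: n; apply: (cvgr_ge 1) => //; lra.
have s0 : 0 < sigma n.
  by near: n; apply: (cvgr_gt 1).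
have ln1 : 1 <= ln n%:R :> R.
  by near: n; exact: (cvgryPge _).1 (@cvg_ln_nat R) _.
have D1 : 1 <= D n.
  have : 1 * log2 (n%:R : R) ^+ 3 <= n%:R * p n /\ (d n)%:R <= log2 (n%:R : R).
    by near: n; exact: (mean_degree_ge hd hp hdiam hpd ltr01).
  case=> h hl; apply: le_trans h; rewrite mul1r exprn_ege1 //.
  by apply: le_trans hl; rewrite ler1n; apply: leq_trans (hd n).
have D0 : 0 < D n by exact: lt_le_trans D1.
pose eps := chernoff_dev p n.
have eps0 : 0 <= eps by exact: sqrtr_ge0.
have epsE : D n * eps ^+ 2 = 24 * ln n%:R.
  rewrite sqr_sqrtr; first by rewrite mulrC divfK // gt_eqF.
  by apply: divr_ge0; [rewrite mulr_ge0 //; lra | exact: ltW].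
have eD : 1 <= eps * D n.
  rewrite -(@ler_pXn2r R 2) ?nnegrE //; last by rewrite mulr_ge0 // ltW.
  have -> : (eps * D n) ^+ 2 = D n * eps ^+ 2 * D n by ring.
  by rewrite epsE expr1n; nra.
(* The ball lemmas are applied with r = d - 2. *)
have dE : (d n - 1 = (d n - 2).+1)%N.
  by have := hd n; case: (d n) => [|[|k]] // _; rewrite !subSS !subn0.
have eps1 : eps <= 1.
  apply: le_trans d1; rewrite /delta -/eps ler_peMl //.
  have : 1 <= (d n - 1)%:R :> R by rewrite dE ler1n.
  lra.
have l2 := ln2_gt0 R; have l23 := ln2_le R.
(* The constants fit exactly: p^d n^(d-1) >= 2 log n, log n >= (4/3) ln n, and (15/16) 2 (4/3) =
   5/2. *)
have hm : 5 / 2 * ln n%:R <= p n * (15 / 16 * D n ^+ (d n - 1)).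
  have h0 : 0 <= p n ^+ d n * n%:R ^+ (d n - 1) - 2 * log2 (n%:R : R).
    by near: n; exact: (cvgryPge _).1 hpd _.
  have -> : p n * (15 / 16 * D n ^+ (d n - 1)) =
      15 / 16 * (p n ^+ d n * n%:R ^+ (d n - 1)).
    have dS : d n = (d n - 1).+1 by rewrite subn1 prednK // (leq_ltn_trans _ (hd n)).
    by rewrite /D exprMn [in p n ^+ d n]dS exprS; ring.
  have : ln n%:R * (4 / 3) <= log2 (n%:R : R).
    rewrite ler_wpM2l //; first by lra.
    by rewrite -[leLHS]invrK lef_pV2 ?posrE ?invr_gt0 //; lra.
  lra.
have e01 : 0 <= eps <= 1 by rewrite eps0.
have hD : 24 * ln n%:R <= D n * eps ^+ 2 by rewrite epsE.
have m0 : 0 < 15 / 16 * D n ^+ (d n - 1) by rewrite mulr_gt0 // exprn_gt0.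
apply: (le_trans (gnp_prob_expanding p01 D1 e01 n0 hD m0 hm)).
apply: gnp_prob_mono => // G reg.
move: (erefl (delta n)) (erefl (tau n)); rewrite {1}/delta {1}/tau dE => deltaE tauE.
rewrite dE in reg.
have := ball_number_expanding reg n1 (ltW p0) eps0 D1 eD tauE t1.
rewrite -/eps in deltaE; rewrite deltaE -/(l n) -/(sigma n) => /(_ d1 u2 l15 s0).
rewrite -dE in tauE *.
have -> : n%:R / (n%:R * p n) ^+ (d n - 1) = (tau n)^-1 by rewrite /tau invf_div.
have -> : log2 (n%:R : R) / log2 (tau n)^-1 = ln n%:R / L n.
  by rewrite /log2 -[ln (tau n)^-1]/(L n) invf_div mulrA divfK ?gt_eqF.
rewrite subKr => /andP[-> up] /=; apply: (le_trans up).
rewrite le_eqVlt; apply/orP; left; apply/eqP.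
by field; rewrite !gt_eqF //; lra.
Unshelve. all: by end_near. Qed.
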